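(* Let $p \ge 3$ be an integer, let $\mathcal{A} = (A_k)_{1 \le k \le p}$ be a family of $p$ distinct points of a finite-dimensional real affine space $E$, and let $t = (t_k)_{1 \le k \le p} \in \, ]0,1[^p$. Define $(t^{(m)})_{m \in \mathbb{N}}$ by $t^{(0)} = t$ and $$t_k^{(m+1)} = \prod_{\substack{1 \le i \le p \\ i \ne k}} \bigl(1 - t_i^{(m)}\bigr), \qquad 1 \le k \le p,\ m \in \mathbb{N},$$ and for each $m \in \mathbb{N}$ let $G_m$ be the barycenter of the points $A_k$ ($1 \le k \le p$) with respective weights $\prod_{1 \le i \le p,\, i \ne k} (1 - t_i^{(m)})$. Then the sequence $(G_m)_{m \in \mathbb{N}}$ converges exponentially to the center of gravity $G$ (the equal-weight barycenter) of $A_1, \dots, A_p$.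
   Context: The sequence $(G_m)_{m\in\mathbb{N}}$ is called the dual sequence of the $t$-barypolygonal sequence of $\mathcal{A}$. The barycenter of points $A_k$ with weights $w_k > 0$ is the unique point $B$ of $E$ with $\sum_k w_k \overrightarrow{BA_k} = 0$. Exponential convergence of $(G_m)$ to $G$ means that, for a norm on the direction of $E$, there exist $C \ge 0$ and $\rho \in \, ]0,1[$ with $\|\overrightarrow{G G_m}\| \le C \rho^m$ for all $m \in \mathbb{N}$. *)

(* Defs.v *)
From HB Require Import structures.
From mathcomp Require Import all_boot all_order all_algebra.
From mathcomp Require Import reals.

Set Implicit Arguments.
Unset Strict Implicit.
Unset Printing Implicit Defensive.

Import Order.TTheory GRing.Theory Num.Theory.
Local Open Scope ring_scope.

(* Weyl's axioms; finite-dimensionality is carried by [vectType]. *)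
Record affineSpace (R : realType) := AffineSpace {
  aff_point :> Type;
  direction : vectType R;
  vec : aff_point -> aff_point -> direction;
  affine_inhabited : inhabited aff_point;
  affine_translation : forall (a : aff_point) (v : direction), exists! b, vec a b = v;
  affine_chasles : forall a b c : aff_point, vec a b + vec b c = vec a c
}.

Definition is_barycenter (R : realType) (E : affineSpace R) (p : nat)
    (A : 'I_p -> E) (w : 'I_p -> R) (B : E) : Prop :=
  \sum_(k < p) w k *: vec B (A k) = 0.

Lemma barycenter_exists_unique (R : realType) (E : affineSpace R) (p : nat)
    (A : 'I_p -> E) (w : 'I_p -> R) :
  (0 < p)%N -> (forall k, 0 < w k) -> exists! B : E, is_barycenter A w B.
Proof.
case: p A w => // p A w _ w_gt0.
pose W := \sum_(k < p.+1) w k.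
have W_neq0 : W != 0.
  apply: lt0r_neq0; rewrite /W (bigD1 ord0) //=.
  by apply: ltr_wpDr; rewrite ?sumr_ge0 // => i _; apply/ltW.
pose S := \sum_(k < p.+1) w k *: vec (A ord0) (A k).
have vecE (a b c : E) : vec b c = vec a c - vec a b.
  by rewrite -(affine_chasles a b c) addrC addKr.
have baryE (B : E) : is_barycenter A w B <-> vec (A ord0) B = W^-1 *: S.
  have sumE : \sum_(k < p.+1) w k *: vec B (A k) = S - W *: vec (A ord0) B.
    under eq_bigr => k _ do rewrite (vecE (A ord0)) scalerBr.
    by rewrite sumrB -scaler_suml.
  rewrite /is_barycenter sumE; split=> [/eqP|->].
    by rewrite subr_eq0 => /eqP ->; rewrite scalerA mulVf // scale1r.
  by rewrite scalerA divff // scale1r subrr.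
have [B [defB uniqB]] := affine_translation (A ord0) (W^-1 *: S).
exists B; split=> [|B' /baryE /uniqB //].
exact/baryE.
Qed.

Definition is_norm (R : realType) (V : vectType R) (N : V -> R) : Prop :=
  [/\ forall u v, N (u + v) <= N u + N v,
      forall (a : R) (v : V), N (a *: v) = `|a| * N v
    & forall v, N v = 0 -> v = 0].

Lemma norm_exists (R : realType) (V : vectType R) :
  exists N : V -> R, is_norm N.
Proof.
exists (fun v => \sum_i `|coord (vbasis {:V}) i v|); split.
- move=> u v; rewrite -big_split; apply: ler_sum => i _ /=.
  by rewrite linearD ler_normD.
- move=> a v; rewrite mulr_sumr; apply: eq_bigr => i _.
  by rewrite linearZ normrM.
- move=> v /eqP; rewrite psumr_eq0 // => /allP coord0.
  rewrite (coord_vbasis (memvf v)) big1 // => i _.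
  have /eqP := coord0 i (mem_index_enum i).
  by move/normr0P/eqP => ->; rewrite scale0r.
Qed.

(* All norms on a finite-dimensional space being equivalent, the condition does
   not depend on the norm; it is required here for every one of them. *)
Definition converges_exponentially (R : realType) (E : affineSpace R)
    (Gm : nat -> E) (G : E) : Prop :=
  forall N : direction E -> R, is_norm N ->
    exists C rho : R, [/\ 0 <= C, 0 < rho < 1 &
      forall m, N (vec G (Gm m)) <= C * rho ^+ m].

Definition prod_compl (R : realType) (p : nat) (t : 'I_p -> R) (k : 'I_p) : R :=
  \prod_(i < p | i != k) (1 - t i).

Fixpoint iter_t (R : realType) (p : nat) (t : 'I_p -> R) (m : nat) : 'I_p -> R :=
  if m is m'.+1 then prod_compl (iter_t t m') else t.

Definition is_dual_sequence (R : realType) (E : affineSpace R) (p : nat)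
    (A : 'I_p -> E) (t : 'I_p -> R) (Gm : nat -> E) : Prop :=
  forall m, is_barycenter A (prod_compl (iter_t t m)) (Gm m).

(* Main.v *)
Require Import Defs.
From mathcomp Require Import all_boot all_order all_algebra.
From mathcomp Require Import reals.
From mathcomp Require Import lra.

Import Order.TTheory GRing.Theory Num.Theory.
Local Open Scope ring_scope.

(** The weights of [Gm m] are [iter_t t m.+1], so everything rests on showing
    that these weights become equal, relative to their size, at a geometric
    rate. An absolute estimate would not do: the weights may approach a
    cycle alternating between values near 0 and values near 1.

    The relative discrepancy of a weight family is measured by the least [d]
    such that any weight is at most [1 + d] times any other. A single step of
    the recursion may increase [d], but two consecutive steps always halve it
    at least ([spread_le_two_steps]). Indeed, with [u = prod_compl s] and
    [w = prod_compl u], the ratio [w k / w l] equals [(1 - u l) / (1 - u k)],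
    that is [(1 - Q + Q * s k) / (1 - Q + Q * s l)] where [Q] is the product of
    the [1 - s i] for [i] other than [k] and [l]. Since [p >= 3], one of these
    factors is some [1 - s j], whence [1 - Q >= s j >= Q * s j] and, when
    [s k >= s l], the excess of the ratio over 1 is at most
    [(s k - s l) / (s j + s l)]. Since [s k] is at most [1 + d] times the
    smaller of [s j] and [s l], this is at most [d / 2]: the third weight in
    the denominator is what damps the excess.

    Hence the discrepancy of [iter_t t m] is [O((3/4) ^ m)], because
    [1/2 <= (3/4) ^ 2] ([iter_t_spread]). Finally, the barycenter depends on
    the weights in a Lipschitz way for this discrepancy
    ([barycenter_dist_le]). *)

(** * Relative discrepancy of the weights *)

Definition spread_le {R : realType} {p : nat} (d : R) (w : 'I_p -> R) : Prop :=
  forall k l, w k <= (1 + d) * w l.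

Lemma spread_leW {R : realType} {p : nat} (d d' : R) (w : 'I_p -> R) :
  (forall k, 0 < w k) -> d <= d' -> spread_le d w -> spread_le d' w.
Proof.
move=> w_gt0 dd' wd k l; apply: le_trans (wd k l) _.
by rewrite ler_pM2r // lerD2l.
Qed.

Lemma spread_le_exists {R : realType} {p : nat} (w : 'I_p -> R) :
  (forall k, 0 < w k) -> exists2 d : R, 0 <= d & spread_le d w.
Proof.
move=> w_gt0; have q_ge0 k l : 0 <= w k / w l by rewrite divr_ge0 // ltW.
exists (\sum_k \sum_l w k / w l) => [|k l].
  by apply: sumr_ge0 => k _; apply: sumr_ge0.
rewrite -ler_pdivrMr // (bigD1 k) //= (bigD1 l) //=.
have h1 : 0 <= \sum_(i < p | i != l) w k / w i by apply: sumr_ge0.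
have h2 : 0 <= \sum_(i < p | i != k) \sum_j w i / w j.
  by apply: sumr_ge0 => i _; apply: sumr_ge0.
lra.
Qed.

(** * Contraction in two steps *)

Lemma exists_third {p : nat} (k l : 'I_p) :
  (3 <= p)%N -> exists2 j : 'I_p, j != k & j != l.
Proof.
move=> p_ge3; have /card_gt0P[j] : (0 < #|predC (mem [:: k; l])|)%N.
  have := cardC (mem [:: k; l]); have := card_size [:: k; l].
  rewrite card_ord /= => le2 cardp; rewrite -(ltn_add2l #|[:: k; l]|) addn0.
  by apply: leq_ltn_trans le2 _; rewrite cardp.
by rewrite !inE negb_or => /andP[jk jl]; exists j.
Qed.

Lemma prod1B_bounds {R : realType} {p : nat} (P : pred 'I_p) (t : 'I_p -> R)
    (j : 'I_p) :
  (forall k, 0 < t k < 1) -> P j ->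
  0 < \prod_(i < p | P i) (1 - t i) <= 1 - t j.
Proof.
move=> t01 Pj; have t_gt0 k : 0 < 1 - t k by have := t01 k; lra.
rewrite prodr_gt0 //= (bigD1 j) //=; apply: ler_piMr; first exact: ltW.
apply: prodr_ile1 => i _; rewrite ltW //=.
by have := t01 i; lra.
Qed.

Lemma prod_compl_bounds {R : realType} {p : nat} (t : 'I_p -> R) :
  (3 <= p)%N -> (forall k, 0 < t k < 1) -> forall k, 0 < prod_compl t k < 1.
Proof.
move=> p_ge3 t01 k; have [j jk _] := exists_third k k p_ge3.
have /andP[-> le_j] := @prod1B_bounds R p (fun i => i != k) t j t01 jk.
by apply: le_lt_trans le_j _; have := t01 j; lra.
Qed.

Lemma iter_t_bounds {R : realType} {p : nat} (t : 'I_p -> R) :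
  (3 <= p)%N -> (forall k, 0 < t k < 1) ->
  forall m k, 0 < iter_t t m k < 1.
Proof. by move=> p_ge3 t01; elim=> //= m; apply: prod_compl_bounds. Qed.

(** Both sides are the full product of the [1 - u i]; this turns a ratio of
    two weights into a ratio of two factors. *)
Lemma prod_compl_cross {R : realType} {p : nat} (u : 'I_p -> R) (k l : 'I_p) :
  prod_compl u k * (1 - u k) = prod_compl u l * (1 - u l).
Proof.
have full i : prod_compl u i * (1 - u i) = \prod_(n < p) (1 - u n).
  by rewrite (bigD1 i) //= mulrC.
by rewrite !full.
Qed.

(** The estimate of the excess explained above, with the denominators cleared:
    [key] compares [1 - prod_compl s l] with [1 - prod_compl s k]. *)
Lemma spread_le_two_steps {R : realType} {p : nat} (s : 'I_p -> R) (d : R) :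
  (3 <= p)%N -> (forall k, 0 < s k < 1) -> 0 <= d ->
  spread_le d s -> spread_le (d / 2) (prod_compl (prod_compl s)).
Proof.
move=> p_ge3 s01 d_ge0 sd k l.
have u01 := prod_compl_bounds s p_ge3 s01.
have w_gt0 i : 0 < prod_compl (prod_compl s) i.
  by case/andP: (prod_compl_bounds _ p_ge3 u01 i).
have [->|kl] := eqVneq k l; first by have := w_gt0 l; nra.
have [j jk jl] := exists_third k l p_ge3.
pose Q := \prod_(i < p | (i != k) && (i != l)) (1 - s i).
have uk : prod_compl s k = (1 - s l) * Q.
  by rewrite /prod_compl (bigD1 l) //= eq_sym.
have ul : prod_compl s l = (1 - s k) * Q.
  rewrite /prod_compl (bigD1 k) //=; congr (_ * _).
  by apply: eq_bigl => i; rewrite andbC.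
have /andP[Q_gt0 Qj] : 0 < Q <= 1 - s j by apply: prod1B_bounds; rewrite ?jk.
have /andP[sj0 sj1] := s01 j.
(* Compare [s k] with the smaller of [s j] and [s l], which is at most their mean. *)
have diff_le : s k - s l <= d / 2 * (s j + s l).
  have := sd k l; have := sd k j; have [jl_le|lj_lt] := leP (s j) (s l).
    have : d * s j <= d * s l by rewrite ler_wpM2l.
    lra.
  have : d * s l <= d * s j by rewrite ler_wpM2l // ltW.
  lra.
have Qdiff : Q * (s k - s l) <= d / 2 * (1 - Q + Q * s l).
  have QM : Q * (s k - s l) <= Q * (d / 2 * (s j + s l)) by rewrite ler_pM2l.
  have Qsj : Q * s j <= 1 - Q.
    have : Q * s j <= s j by rewrite ler_piMl; lra.
    lra.
  have : d / 2 * (Q * s j) <= d / 2 * (1 - Q) by rewrite ler_wpM2l //; lra.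
  lra.
have key : 1 - prod_compl s l <= (1 + d / 2) * (1 - prod_compl s k).
  by rewrite uk ul; lra.
have uk_lt1 : 0 < 1 - prod_compl s k by have := u01 k; lra.
rewrite -(ler_pM2r uk_lt1) (prod_compl_cross _ k l) mulrAC [leRHS]mulrC.
by rewrite ler_pM2l.
Qed.

Lemma iter_t_spread {R : realType} {p : nat} (t : 'I_p -> R) :
  (3 <= p)%N -> (forall k, 0 < t k < 1) ->
  exists2 D : R, 0 <= D & forall m, spread_le (D * (3 / 4) ^+ m) (iter_t t m).
Proof.
move=> p_ge3 t01; have it01 := iter_t_bounds t p_ge3 t01.
have it_gt0 m k : 0 < iter_t t m k by case/andP: (it01 m k).
have [d0 d0_ge0 spread0] := spread_le_exists _ (it_gt0 0).
have [d1 d1_ge0 spread1] := spread_le_exists _ (it_gt0 1).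
(* The recursion has step two, so [D] must account for both parities; the
   factor 2 compensates for [3/4] at [m = 1]. *)
exists (d0 + 2 * d1) => [|m]; first lra.
have D_ge0 n : 0 <= (d0 + 2 * d1) * (3 / 4) ^+ n.
  by rewrite mulr_ge0 ?exprn_ge0 //; lra.
suff [//] : spread_le ((d0 + 2 * d1) * (3 / 4) ^+ m) (iter_t t m) /\
            spread_le ((d0 + 2 * d1) * (3 / 4) ^+ m.+1) (iter_t t m.+1).
elim: m => [|m [spreadm spreadSm]]; split=> //.
- by apply: spread_leW spread0; rewrite // expr0; lra.
- by apply: spread_leW spread1; rewrite // expr1; lra.
apply: spread_leW (spread_le_two_steps _ _ p_ge3 (it01 m) (D_ge0 m) spreadm).
  exact: (it_gt0 m.+2).
by have := D_ge0 m; rewrite 2!exprS; lra.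
Qed.

(** * Dependence of the barycenter on the weights *)

Lemma vec_barycenter {R : realType} {E : affineSpace R} {p : nat}
    (A : 'I_p -> E) (w : 'I_p -> R) (O B : E) :
  is_barycenter A w B ->
  (\sum_k w k) *: vec O B = \sum_k w k *: vec O (A k).
Proof.
move=> baryB; under [RHS]eq_bigr => k _ do
  rewrite -(affine_chasles O B (A k)) scalerDr.
by rewrite big_split /= -scaler_suml baryB addr0.
Qed.

Lemma is_norm0 {R : realType} {V : vectType R} {N : V -> R} :
  is_norm N -> N 0 = 0.
Proof. by case=> _ NZ _; rewrite -(scale0r 0) NZ normr0 mul0r. Qed.

Lemma is_norm_ge0 {R : realType} {V : vectType R} {N : V -> R} :
  is_norm N -> forall v, 0 <= N v.
Proof.
move=> normN v; have [ND NZ _] := normN; have := ND v (- v).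
by rewrite subrr (is_norm0 normN) -scaleN1r NZ normrN1; lra.
Qed.

Lemma is_norm_sum {R : realType} {V : vectType R} {N : V -> R} :
  is_norm N -> forall (I : Type) (r : seq I) (F : I -> V),
  N (\sum_(i <- r) F i) <= \sum_(i <- r) N (F i).
Proof.
move=> normN I r F; have [ND _ _] := normN.
elim/big_ind2: _ => [|u a v b ua vb|//]; first by rewrite (is_norm0 normN).
by apply: le_trans (ND _ _) _; apply: lerD.
Qed.

(** Seen from [G], the vectors to the [A k] have sum zero, so subtracting a
    constant from all the weights does not change their weighted sum; with one
    of the weights as this constant, only discrepancies remain. *)
Lemma barycenter_dist_le {R : realType} {E : affineSpace R} {p : nat}
    (A : 'I_p -> E) (w : 'I_p -> R) (d : R) (B G : E)
    (N : direction E -> R) :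
  (0 < p)%N -> (forall k, 0 < w k) -> 0 <= d -> spread_le d w ->
  is_barycenter A w B -> is_barycenter A (fun=> 1) G -> is_norm N ->
  N (vec G B) <= d * \sum_k N (vec G (A k)).
Proof.
move=> p_gt0 w_gt0 d_ge0 wd baryB baryG normN.
have [_ NZ _] := normN.
pose o := Ordinal p_gt0; pose W := \sum_k w k.
have w_leW k : w k <= W.
  by rewrite /W (bigD1 k) //= lerDl sumr_ge0 // => i _; apply: ltW.
have W_gt0 : 0 < W by apply: lt_le_trans (w_gt0 o) (w_leW o).
have sum0 : \sum_k vec G (A k) = 0.
  by rewrite -[RHS]baryG; apply: eq_bigr => k _; rewrite scale1r.
have WE : W *: vec G B = \sum_k (w k - w o) *: vec G (A k).
  rewrite (vec_barycenter A w G B baryB).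
  under [RHS]eq_bigr => k _ do rewrite scalerBl.
  by rewrite sumrB -scaler_sumr sum0 scaler0 subr0.
rewrite -(ler_pM2l W_gt0) -[X in X * N _](gtr0_norm W_gt0) -NZ WE.
apply: le_trans (is_norm_sum normN _ _ _) _.
rewrite mulrA mulr_sumr; apply: ler_sum => k _; rewrite NZ.
rewrite ler_wpM2r ?(is_norm_ge0 normN) // ler_norml.
have := wd k o; have := wd o k.
have : d * w k <= d * W by rewrite ler_wpM2l.
have : d * w o <= d * W by rewrite ler_wpM2l.
lra.
Qed.

(** * Exponential convergence *)

Theorem mainTheorem2 (R : realType) (E : affineSpace R) (p : nat)
    (A : 'I_p -> E) (t : 'I_p -> R) (Gm : nat -> E) (G : E) :
  (3 <= p)%N ->
  injective A ->
  (forall k, 0 < t k < 1) ->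
  is_dual_sequence A t Gm ->
  is_barycenter A (fun=> 1) G ->
  converges_exponentially Gm G.
Proof.
move=> p_ge3 _ t01 baryGm baryG N normN.
have [D D_ge0 spreadD] := iter_t_spread t p_ge3 t01.
have S_ge0 : 0 <= \sum_k N (vec G (A k)).
  by apply: sumr_ge0 => k _; apply: is_norm_ge0.
have pow_ge0 m : 0 <= (3 / 4) ^+ m :> R by rewrite exprn_ge0 //; lra.
exists (D * \sum_k N (vec G (A k))), (3 / 4).
split=> [||m]; [exact: mulr_ge0|lra|].
have w01 := iter_t_bounds t p_ge3 t01 m.+1.
have w_gt0 k : 0 < iter_t t m.+1 k by case/andP: (w01 k).
rewrite mulrAC; apply: (barycenter_dist_le A (iter_t t m.+1)) => //.
- exact: leq_trans p_ge3.
- exact: mulr_ge0.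
- apply: spread_leW (spreadD m.+1) => //.
  by rewrite ler_wpM2l // exprS; have := pow_ge0 m; lra.
- exact: baryGm.
Qed.
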